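(* Let $n>1$ be an integer and $m_1,m_2>0$. Every solution of the $(n+1)$-body problem of the type described in the context with $c_1\neq0$, $c_2<0$ and $$2c_1^2c_2+na_nm_2^2\big(2m_1+(b_n-a_n)m_2\big)<0$$ is bounded, where $a_n=\sum_{j=1}^{n-1}\frac{1-e^{2\pi ji/n}}{|e^{2\pi ji/n}-1|^3}$ and $b_n=\sum_{j=1}^{n-1}|e^{2\pi ji/n}-1|^{-1}$.
   Context: The gravitational constant is $1$. The solutions considered are the solutions of the $(n+1)$-body problem, with one body $x$ of mass $m_1$ and $n$ bodies $y^1,\dots,y^n$ of mass $m_2$, of the form $$x=(0,0,f),\qquad y^j=\Big(r\cos\big(\theta+\tfrac{2(j-1)\pi}{n}\big),\ r\sin\big(\theta+\tfrac{2(j-1)\pi}{n}\big),\ -\tfrac{m_1}{nm_2}f\Big),\quad j=1,\dots,n,$$ where $r>0$ and $$\ddot f=-\frac{(m_1+nm_2)f}{h^3},\qquad \ddot r=\frac{c_1^2}{r^3}-a_n\frac{m_2}{r^2}-\frac{m_1r}{h^3},\qquad r^2\dot\theta=c_1,$$ with $c_1$ a constant and $h=\sqrt{r^2+\big(\frac{m_1+nm_2}{nm_2}\big)^2f^2}$. The number $c_2$ is the conserved total energy (kinetic plus potential): $$c_2=\tfrac12\Big(m_1|\dot x|^2+m_2\sum_{j}|\dot y^j|^2\Big)-\sum_j\frac{m_1m_2}{|x-y^j|}-\sum_{i<j}\frac{m_2^2}{|y^i-y^j|}.$$ Bounded means that the positions of all bodies remain in a bounded subset of $\mathbb{R}^3$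 for all time. *)

(* Defs.v *)
From HB Require Import structures.
From mathcomp Require Import all_boot all_order all_algebra.
From mathcomp Require Import all_classical all_reals all_analysis.
From mathcomp Require Import complex.

Set Implicit Arguments.
Unset Strict Implicit.
Unset Printing Implicit Defensive.

Import Order.TTheory GRing.Theory Num.Theory.
Import numFieldNormedType.Exports.

Local Open Scope ring_scope.
Local Open Scope classical_set_scope.

Section Constants.
Local Open Scope complex_scope.
Variables (R : realType) (n : nat).

Definition cexpi (phi : R) : R[i] := cos phi +i* sin phi.

Definition root1 (j : nat) : R[i] := cexpi (2 * pi * j%:R / n%:R).

Definition anC : R[i] :=
  \sum_(1 <= j < n) (1 - root1 j) / `|root1 j - 1| ^+ 3.

Definition bnC : R[i] := \sum_(1 <= j < n) `|root1 j - 1|^-1.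

(* Both sums are real (see [anCE] and [bnCE]): taking the real part only
   changes the type. *)
Definition an : R := complex.Re anC.
Definition bn : R := complex.Re bnC.

End Constants.

Section ConstantsReal.
Local Open Scope complex_scope.
Variables (R : realType) (n : nat).

Lemma root1_conj (j : nat) : (0 < j < n)%N ->
  root1 R n (n - j) = (root1 R n j)^*.
Proof.
move=> /andP[j0 jn]; rewrite /root1 /cexpi.
have n0 : n%:R != 0 :> R by rewrite pnatr_eq0 -lt0n (leq_ltn_trans _ jn).
have -> : 2 * pi * (n - j)%:R / n%:R = - (2 * pi * j%:R / n%:R) + pi *+ 2 :> R.
  rewrite natrB 1?ltnW// mulrBr mulrBl mulfK// addrC; congr (_ + _).
  by rewrite mulr_natl.
by rewrite cosD2pi sinD2pi cosN sinN.
Qed.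

Lemma anCE : (an R n)%:C = anC R n.
Proof.
suff : complex.Im (anC R n) = 0 by rewrite /an; case: (anC R n) => a b /= ->.
have nJ (z : R[i]) : `|z|^* = `|z| by rewrite normc_def conjc_real.
have aJ : (anC R n)^* = anC R n.
  rewrite /anC rmorph_sum [RHS]big_nat_rev !big_nat.
  apply: eq_bigr => j jn.
  rewrite add1n subSS root1_conj// rmorphM fmorphV rmorphXn [X in X / _]rmorphB.
  rewrite rmorph1 -[root1 R n j - 1]conjcK normcJ rmorphB rmorph1.
  by congr (_ / _ ^+ 3); exact: nJ.
by case: (anC R n) aJ => a b [] /eqP; rewrite eq_sym -addr_eq0 -mulr2n mulrn_eq0 => /eqP.
Qed.

Lemma bnCE : (bn R n)%:C = bnC R n.
Proof.
have : bnC R n \is Num.real by apply: rpred_sum => j _; rewrite rpredV normr_real.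
by rewrite /bn => /complex_realP[x ->].
Qed.

End ConstantsReal.

Section Space.
Variable R : realType.

Definition vec3 (a b c : R) : 'rV[R]_3 := \row_(i < 3) [:: a; b; c]`_i.

(* The library norm on row vectors is the sup norm; this is the Euclidean one. *)
Definition enorm (v : 'rV[R]_3) : R := Num.sqrt (\sum_(i < 3) v 0 i ^+ 2).

End Space.

Section NBody.
Variables (R : realType) (n : nat) (m1 m2 : R).
Variables (x : R -> 'rV[R]_3) (y : 'I_n -> R -> 'rV[R]_3).

Definition pull (m : R) (p q : 'rV[R]_3) : 'rV[R]_3 :=
  (m / enorm (q - p) ^+ 3) *: (q - p).

Definition twice_derivable (V : normedModType R) (J : set R) (g : R -> V) :=
  forall t, J t -> derivable g t 1 /\ derivable (derive1 g) t 1.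

Record newton_solution (J : set R) : Prop := NewtonSolution {
  newton_derivable_x : twice_derivable J x;
  newton_derivable_y : forall j, twice_derivable J (y j);
  newton_noncoll_xy : forall t, J t -> forall j, x t <> y j t;
  newton_noncoll_yy : forall t, J t -> forall i j, i <> j -> y i t <> y j t;
  newton_x : forall t, J t ->
    derive1 (derive1 x) t = \sum_(j < n) pull m2 (x t) (y j t);
  newton_y : forall t, J t -> forall j,
    derive1 (derive1 (y j)) t =
      pull m1 (y j t) (x t) + \sum_(k < n | k != j) pull m2 (y j t) (y k t)
}.

Definition energy (t : R) : R :=
  2^-1 * (m1 * enorm (derive1 x t) ^+ 2
          + m2 * \sum_(j < n) enorm (derive1 (y j) t) ^+ 2)
  - \sum_(j < n) m1 * m2 / enorm (x t - y j t)
  - \sum_(i < n) \sum_(j < n | (i < j)%N) m2 ^+ 2 / enorm (y i t - y j t).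

Definition bounded_motion (J : set R) : Prop :=
  exists2 B : set 'rV[R]_3, bounded_set B &
    forall t, J t -> B (x t) /\ forall j, B (y j t).

End NBody.

Section RingSolutions.
Variables (R : realType) (n : nat) (m1 m2 : R).

Definition ring_x (f : R -> R) (t : R) : 'rV[R]_3 := vec3 0 0 (f t).

(* The index [j : 'I_n] starts at 0, hence [j] instead of [j - 1]. *)
Definition ring_y (f r theta : R -> R) (j : 'I_n) (t : R) : 'rV[R]_3 :=
  let phi := theta t + 2 * j%:R * pi / n%:R in
  vec3 (r t * cos phi) (r t * sin phi) (- (m1 / (n%:R * m2)) * f t).

Definition hdist (f r : R -> R) (t : R) : R :=
  Num.sqrt (r t ^+ 2
            + ((m1 + n%:R * m2) / (n%:R * m2)) ^+ 2 * f t ^+ 2).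

Record ring_solution (c1 : R) (J : set R) (f r theta : R -> R)
    (x : R -> 'rV[R]_3) (y : 'I_n -> R -> 'rV[R]_3) : Prop := RingSolution {
  ring_newton : newton_solution m1 m2 x y J;
  ring_xE : forall t, J t -> x t = ring_x f t;
  ring_yE : forall t, J t -> forall j, y j t = ring_y f r theta j t;
  ring_r_gt0 : forall t, J t -> 0 < r t;
  ring_derivable_f : twice_derivable J f;
  ring_derivable_r : twice_derivable J r;
  ring_derivable_theta : forall t, J t -> derivable theta t 1;
  ring_f : forall t, J t ->
    derive1 (derive1 f) t = - ((m1 + n%:R * m2) * f t) / hdist f r t ^+ 3;
  ring_r : forall t, J t ->
    derive1 (derive1 r) t = c1 ^+ 2 / r t ^+ 3 - an R n * (m2 / r t ^+ 2)
                  - m1 * r t / hdist f r t ^+ 3;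
  ring_theta : forall t, J t -> r t ^+ 2 * derive1 theta t = c1
}.

End RingSolutions.

(* Main.v *)
(* Since 1 - cos = d ^ 2 / 2 for the distance d from a root of unity to 1, one has
   a_n = b_n / 2, and the energy of a ring solution is that of a motion of (r, f)
   with potential n m2 (c1^2 / (2 r^2) - a_n m2 / r - m1 / h).  The first two
   terms are at least - n a_n^2 m2^3 / (2 c1^2), which the hypothesis puts above
   c2; so conservation of energy bounds m1 / h away from 0, and h dominates the
   distance of every body to the origin. *)
Require Import Defs.
From HB Require Import structures.
From mathcomp Require Import all_boot all_order all_algebra.
From mathcomp Require Import all_classical all_reals all_analysis.
From mathcomp Require Import complex ring zify.

Import Order.TTheory GRing.Theory Num.Theory.
Import numFieldNormedType.Exports.

Local Open Scope classical_set_scope.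
Local Open Scope ring_scope.

(** * Chord lengths of the regular polygon and the constants $a_n$, $b_n$ *)

(** The real number $|e^{2\pi ki/n}-1|$, in the form given by the law of cosines. *)
Definition chord (R : realType) (n k : nat) : R :=
  Num.sqrt (2 - 2 * cos (2 * pi * k%:R / n%:R)).

Lemma normc_root1_sub1 (R : realType) (n k : nat) :
  `|Defs.root1 R n k - 1| = (chord R n k)%:C%C.
Proof.
rewrite normc_def /chord /Defs.root1 /cexpi /=; congr (Num.sqrt _)%:C%C.
by rewrite oppr0 addr0 sin2cos2; ring.
Qed.

Lemma bn_chord (R : realType) (n : nat) :
  bn R n = \sum_(1 <= k < n) (chord R n k)^-1.
Proof.
rewrite /bn /bnC raddf_sum; apply: eq_bigr => k _.
by rewrite normc_root1_sub1 -fmorphV.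
Qed.

(** Holds term by term: the real part of the numerator is $d^2/2$, and $(d^2/2)/d^3=1/(2d)$. *)
Lemma an_bn (R : realType) (n : nat) : an R n = bn R n / 2.
Proof.
rewrite bn_chord /an /anC raddf_sum mulr_suml; apply: eq_bigr => k _.
rewrite normc_root1_sub1 -rmorphXn -fmorphV /Defs.root1 /cexpi /=.
set d := chord R n k.
have d2 : d ^+ 2 = 2 - 2 * cos (2 * pi * k%:R / n%:R).
  by rewrite sqr_sqrtr// subr_ge0 -[leRHS]mulr1 ler_pM2l// cos_le1.
have -> : 1 - cos (2 * pi * k%:R / n%:R) = d ^+ 2 / 2 by rewrite d2; field.
(* The range of [k] is not at hand here; when $d=0$ both sides vanish, as the inverse of $0$ is
   $0$. *)
rewrite mulr0 subr0; have [->|d0] := eqVneq d 0.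
  by rewrite expr0n/= invr0 !mul0r.
by field.
Qed.

Lemma an_ge0 (R : realType) (n : nat) : 0 <= an R n.
Proof.
by rewrite an_bn bn_chord divr_ge0// sumr_ge0// => k _; rewrite invr_ge0 sqrtr_ge0.
Qed.

Lemma chord_rev (R : realType) (n k : nat) : (0 < k < n)%N ->
  chord R n (n - k) = chord R n k.
Proof.
by move=> /root1_conj/(congr1 (@complex.Re R)) /= ck; rewrite /chord ck.
Qed.

(** Double counting: twice the sum over pairs runs over ordered pairs, and for each fixed $i$ the
    differences with the other indices cover $1,\dots,n-1$ once modulo $n$. *)
Lemma sum_cyclic_pairs (V : nmodType) (n : nat) (g : nat -> V) :
    (forall k, (0 < k < n)%N -> g (n - k)%N = g k) ->
  (\sum_(i < n) \sum_(j < n | (i < j)%N) g (j - i)%N) *+ 2 =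
  (\sum_(1 <= k < n) g k) *+ n.
Proof.
move=> gN; rewrite mulr2n [in X in X + _](exchange_big_dep xpredT)//= -big_split/=.
rewrite -[X in _ *+ X]card_ord -sumr_const; apply: eq_bigr => i _.
(* Cut the range of $k$ after $i$: $k=i-j$ with $j<i$ fills $1,\dots,i$, and $k=n-(j-i)$ with $j>i$
   fills $i+1,\dots,n-1$. *)
rewrite (big_cat_nat (n := i.+1))//=; congr (_ + _)%R.
  rewrite -(big_ord_widen n (fun j => g (i - j)%N)) 1?ltnW// big_add1/=.
  rewrite [RHS]big_nat_rev/= big_mkord.
  by apply: eq_bigr => k _; congr g; have := ltn_ord k; lia.
rewrite [RHS]big_nat_rev (big_nat_widenl i.+1 0)//= big_mkord.
by apply: eq_bigr => k ik; rewrite -gN; [congr g|]; have := ltn_ord k; lia.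
Qed.

(** * Euclidean distances in the ring configuration *)

Lemma enorm_vec3 (R : realType) (a b c : R) :
  enorm (vec3 a b c) = Num.sqrt (a ^+ 2 + b ^+ 2 + c ^+ 2).
Proof. by rewrite /enorm !big_ord_recr big_ord0 /= add0r !mxE. Qed.

Lemma vec3B (R : realType) (a b c a' b' c' : R) :
  vec3 a b c - vec3 a' b' c' = vec3 (a - a') (b - b') (c - c').
Proof. by apply/rowP => -[[|[|[|//]]] ?]; rewrite !mxE. Qed.

Lemma is_derive_vec3 (R : realType) (a b c : R -> R) (t a' b' c' : R) :
    is_derive t 1 a a' -> is_derive t 1 b b' -> is_derive t 1 c c' ->
  derive1 (fun s => vec3 (a s) (b s) (c s)) t = vec3 a' b' c'.
Proof.
move=> da db dc.
have dv (i : 'I_3) :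
    is_derive t 1 (fun s => vec3 (a s) (b s) (c s) 0 i) (vec3 a' b' c' 0 i).
  by case: i => -[|[|[|//]]] ?; rewrite mxE/=; under eq_fun do rewrite mxE/=.
rewrite derive1E derive_mx.
  by apply/rowP => i; rewrite mxE derive_val.
by apply/derivable_mxP => i j; rewrite (ord1 i); apply: ex_derive.
Qed.

(** The vertical offset is $f+\frac{m_1}{nm_2}f$, whose coefficient is the factor of $f$ in
    [hdist]. *)
Lemma enorm_ring_xy (R : realType) (n : nat) (m1 m2 : R) (f r theta : R -> R)
    (j : 'I_n) (t : R) : 0 < m2 ->
  enorm (ring_x f t - ring_y m1 m2 f r theta j t) = hdist n m1 m2 f r t.
Proof.
move=> m2_gt0; have n0 : n%:R != 0 :> R by rewrite pnatr_eq0; case: n j => -[].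
rewrite vec3B enorm_vec3 /hdist; congr Num.sqrt.
set phi := theta t + _; rewrite !sub0r !sqrrN !exprMn -mulrDr cos2Dsin2.
by field; rewrite n0 gt_eqF.
Qed.

(** Law of cosines at equal heights and common radius, with angle $2\pi(j-i)/n$. *)
Lemma enorm_ring_yy (R : realType) (n : nat) (m1 m2 : R) (f r theta : R -> R)
    (i j : 'I_n) (t : R) : 0 <= r t -> (i < j)%N ->
  enorm (ring_y m1 m2 f r theta i t - ring_y m1 m2 f r theta j t) =
  r t * chord R n (j - i).
Proof.
move=> r_ge0 ij.
rewrite vec3B enorm_vec3 subrr expr0n addr0 /chord.
rewrite -[X in _ = X * _]ger0_norm// -sqrtr_sqr -sqrtrM ?sqr_ge0//; congr Num.sqrt.
set A := theta t + _; set B := theta t + _.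
have -> : 2 * pi * (j - i)%:R / n%:R = B - A.
  by rewrite /A /B natrB 1?ltnW//; ring.
rewrite cosB.
transitivity (r t ^+ 2 * ((cos A ^+ 2 + sin A ^+ 2) + (cos B ^+ 2 + sin B ^+ 2)
    - 2 * (cos B * cos A + sin B * sin A))); first by ring.
by rewrite !cos2Dsin2.
Qed.

(** * Energy of a ring solution and its conservation *)

Lemma derive0_constant (R : realType) (J : set R) (g : R -> R) (s t : R) :
    is_interval J -> (forall u, J u -> is_derive u 1 g 0) -> J s -> J t ->
  g s = g t.
Proof.
move=> J_itv dg; wlog st : s t / s <= t => [th Js Jt|Js Jt].
  by have [st|/ltW ts] := leP s t; [exact: th|rewrite -(th t s)].
have inJ u : u \in `[s, t] -> J u by rewrite in_itv/=; exact: J_itv.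
have dg_in u : u \in `]s, t[ -> is_derive u 1 g (cst 0 u).
  by move=> /subset_itv_oo_cc /inJ; exact: dg.
have [|u _] := MVT_segment st dg_in.
  by apply: derivable_within_continuous => u /inJ /dg [].
by rewrite mul0r => /eqP; rewrite subr_eq0 => /eqP.
Qed.

Section RingMotion.
Variables (R : realType) (n : nat) (m1 m2 c1 : R) (J : set R).
Variables (f r theta : R -> R) (x : R -> 'rV[R]_3) (y : 'I_n -> R -> 'rV[R]_3).
Hypotheses (n_gt0 : (0 < n)%N) (m1_gt0 : 0 < m1) (m2_gt0 : 0 < m2).
Hypotheses (J_open : open J) (sol : ring_solution m1 m2 c1 J f r theta x y).

Let k : R := (m1 + n%:R * m2) / (n%:R * m2).
Let a : R := an R n.
Let h : R -> R := hdist n m1 m2 f r.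

(** The vertical kinetic energies add up to the first term because
    $m_1+nm_2(\frac{m_1}{nm_2})^2=m_1k$; the rotational one is rewritten with
    $r^2\dot\theta=c_1$. *)
Definition ring_energy (t : R) : R :=
  m1 * k * derive1 f t ^+ 2 / 2
  + n%:R * m2 * (derive1 r t ^+ 2 / 2 + c1 ^+ 2 / 2 * (r t)^-1 ^+ 2
                 - a * m2 / r t - m1 / h t).

Let nR_gt0 : 0 < n%:R :> R. Proof. by rewrite ltr0n. Qed.

Let k_gt0 : 0 < k.
Proof. by rewrite divr_gt0 ?mulr_gt0// addr_gt0// mulr_gt0. Qed.

Let twice_is_derive (g : R -> R) t : twice_derivable J g -> J t ->
  is_derive t 1 g (derive1 g t) /\
  is_derive t 1 (derive1 g) (derive1 (derive1 g) t).
Proof. by move=> dg /dg[dg1 dg2]; rewrite !derive1E; split; exact: derivableP. Qed.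

(** The ring formulas hold on [J] only; openness of [J] makes them hold near [t], so they may be
    differentiated. *)
Let near_derive1 (V : normedModType R) (g g' : R -> V) t :
  {in J, g =1 g'} -> J t -> derive1 g t = derive1 g' t.
Proof.
move=> gg' Jt; rewrite !derive1E; apply: near_eq_derive.
near=> s; apply: gg'; rewrite inE.
by near: s; exact: open_nbhs_nbhs.
Unshelve. all: by end_near. Qed.

Lemma derive1_ring_x t : J t -> derive1 x t = vec3 0 0 (derive1 f t).
Proof.
move=> Jt; rewrite (near_derive1 _ _ (ring_x f) t)//; last first.
  by move=> s; rewrite inE; exact: ring_xE sol s.
have [df _] := twice_is_derive f t (ring_derivable_f sol) Jt.
by apply: is_derive_vec3; apply: is_derive_cst.
Qed.

Lemma enorm_derive1_ring_y j t : J t ->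
  enorm (derive1 (y j) t) ^+ 2 =
  derive1 r t ^+ 2 + c1 ^+ 2 / r t ^+ 2
  + (m1 / (n%:R * m2)) ^+ 2 * derive1 f t ^+ 2.
Proof.
move=> Jt; rewrite (near_derive1 _ _ (ring_y m1 m2 f r theta j) t)//; last first.
  by move=> s; rewrite inE => Js; exact: ring_yE sol s Js j.
have [df _] := twice_is_derive f t (ring_derivable_f sol) Jt.
have [dr _] := twice_is_derive r t (ring_derivable_r sol) Jt.
have dth : is_derive t 1 theta (derive1 theta t).
  by rewrite derive1E; apply: derivableP; exact: ring_derivable_theta sol t Jt.
pose phi0 : R := 2 * j%:R * pi / n%:R.
have dphi : is_derive t 1 (fun s => theta s + phi0) (derive1 theta t).
  by apply: is_derive_eq; rewrite addr0.
have dcos := @is_derive1_comp _ cos _ t _ _ (is_derive_cos _) dphi.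
have dsin := @is_derive1_comp _ sin _ t _ _ (is_derive_sin _) dphi.
have -> := is_derive_vec3 _ _ _ _ t _ _ _ (is_deriveM dr dcos)
  (is_deriveM dr dsin) (is_deriveZ (- (m1 / (n%:R * m2))) df).
rewrite enorm_vec3 sqr_sqrtr ?addr_ge0 ?sqr_ge0// /= /GRing.scale/=.
have r0 : r t != 0 by rewrite gt_eqF// (ring_r_gt0 sol).
have -> : c1 ^+ 2 / r t ^+ 2 = r t ^+ 2 * derive1 theta t ^+ 2.
  by rewrite -(ring_theta sol Jt); field.
have := cos2Dsin2 (theta t + phi0).
set C := cos _; set S := sin _ => CS.
(* Writing $1$ as $C^2+S^2$ on the right leaves a polynomial identity. *)
rewrite -[X in _ = X + _ + _]mul1r -[X in _ = _ + X + _]mul1r -CS.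
by ring.
Qed.

Lemma energy_ring t : J t -> energy m1 m2 x y t = ring_energy t.
Proof.
move=> Jt; have r_gt0 := ring_r_gt0 sol Jt.
rewrite /energy derive1_ring_x// enorm_vec3 expr0n !add0r sqr_sqrtr ?sqr_ge0//.
under eq_bigr do rewrite enorm_derive1_ring_y//.
under [X in _ - X - _]eq_bigr do
  rewrite (ring_xE sol Jt) (ring_yE sol Jt) enorm_ring_xy//.
rewrite !sumr_const card_ord.
(* The chords depend only on $j-i$, so the pair sum is $nb_n/2=na_n$ up to the factor $m_2^2/r$. *)
have -> : \sum_(i < n) \sum_(j < n | (i < j)%N)
    m2 ^+ 2 / enorm (y i t - y j t) = m2 ^+ 2 / r t * (n%:R * a).
  transitivity (m2 ^+ 2 / r t *
      \sum_(i < n) \sum_(j < n | (i < j)%N) (chord R n (j - i))^-1).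
    rewrite mulr_sumr; apply: eq_bigr => i _; rewrite mulr_sumr.
    apply: eq_bigr => j ij; rewrite !(ring_yE sol Jt) enorm_ring_yy ?ltW//.
    by rewrite invfM mulrA.
  congr (_ * _); rewrite /a an_bn bn_chord mulrA mulr_natl.
  rewrite -(@sum_cyclic_pairs _ _ (fun k => (chord R n k)^-1)).
    by rewrite -[X in X / _]mulr_natr mulfK.
  by move=> i ij; rewrite chord_rev.
rewrite /ring_energy /h /k -[X in m2 * X]mulr_natl -[X in _ - X - _]mulr_natl.
have h_gt0 : 0 < hdist n m1 m2 f r t.
  by rewrite sqrtr_gt0 ltr_wpDr ?exprn_gt0// mulr_ge0 ?sqr_ge0.
by field; rewrite !gt_eqF.
Qed.

Let h_gt0 t : J t -> 0 < h t.
Proof.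
move=> /(ring_r_gt0 sol) r_gt0.
by rewrite sqrtr_gt0 ltr_wpDr ?exprn_gt0// mulr_ge0 ?sqr_ge0.
Qed.

Let is_derive_h t : J t ->
  is_derive t 1 h ((r t * derive1 r t + k ^+ 2 * f t * derive1 f t) / h t).
Proof.
move=> Jt; have r_gt0 := ring_r_gt0 sol Jt.
have [df _] := twice_is_derive f t (ring_derivable_f sol) Jt.
have [dr _] := twice_is_derive r t (ring_derivable_r sol) Jt.
pose q s := r s ^+ 2 + k ^+ 2 * f s ^+ 2.
have dq : is_derive t 1 q (2 * (r t * derive1 r t + k ^+ 2 * f t * derive1 f t)).
  by apply: is_derive_eq; rewrite /GRing.scale/=; ring.
have q_gt0 : 0 < q t by rewrite -sqrtr_gt0; exact: h_gt0.
have dh := @is_derive1_comp _ Num.sqrt q t _ _ (is_derive1_sqrt q_gt0) dq.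
apply: (is_derive_eq dh); change (Num.sqrt (q t)) with (h t).
by field; rewrite gt_eqF ?h_gt0.
Qed.

Lemma is_derive_ring_energy t : J t -> is_derive t 1 ring_energy 0.
Proof.
move=> Jt; have r_gt0 := ring_r_gt0 sol Jt.
have [_ df] := twice_is_derive f t (ring_derivable_f sol) Jt.
have [dr ddr] := twice_is_derive r t (ring_derivable_r sol) Jt.
have dh := is_derive_h t Jt.
have r_neq0 : r t != 0 by rewrite gt_eqF.
have h_neq0 : h t != 0 by rewrite gt_eqF ?h_gt0.
have du := is_deriveV r_neq0 dr.
have dv := is_deriveV h_neq0 dh.
rewrite /ring_energy. apply: is_derive_eq.
rewrite (ring_f sol Jt) (ring_r sol Jt) -/(h t) -/a /GRing.scale/=.
(* In this form the $f\dot f$ term from $\ddot f$ cancels the one from the derivative of $1/h$. *)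
have -> : m1 + n%:R * m2 = k * (n%:R * m2) by rewrite divfK// mulf_neq0// gt_eqF.
by field; rewrite r_neq0 h_neq0.
Qed.

Lemma ring_energy_conserved s t : is_interval J -> J s -> J t ->
  ring_energy s = ring_energy t.
Proof.
move=> J_itv.
exact: (derive0_constant R J ring_energy s t J_itv is_derive_ring_energy).
Qed.

(** * From the energy to a bound on the positions *)

Hypothesis c1_neq0 : c1 != 0.

Let gap (c2 : R) : R := - c2 / (n%:R * m2) - a ^+ 2 * m2 ^+ 2 / (2 * c1 ^+ 2).

(* [gap] is the excess of the minimum [- (a m2)^2 / (2 c1^2)] of the effective
   radial potential over the energy per unit mass: only [m1 / h] can fill it. *)
Lemma gap_le_attraction t : J t -> gap (ring_energy t) <= m1 / h t.
Proof.
move=> Jt; rewrite /gap -subr_ge0.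
(* Completing the square in $1/r$ leaves a sum of nonnegative terms: two kinetic ones and the
   square. *)
suff -> : m1 / h t - (- ring_energy t / (n%:R * m2)
      - a ^+ 2 * m2 ^+ 2 / (2 * c1 ^+ 2)) =
    m1 * k / (n%:R * m2) * derive1 f t ^+ 2 / 2 + derive1 r t ^+ 2 / 2
    + (c1 / r t - a * m2 / c1) ^+ 2 / 2.
  have ? : 0 <= m1 * k / (n%:R * m2) by apply: divr_ge0; apply: mulr_ge0; apply: ltW.
  by rewrite !addr_ge0// divr_ge0 ?sqr_ge0// mulr_ge0 ?sqr_ge0.
rewrite /ring_energy; field.
by rewrite c1_neq0 !gt_eqF ?h_gt0// (ring_r_gt0 sol).
Qed.

Lemma hdist_le t : J t -> 0 < gap (ring_energy t) ->
  h t <= m1 / gap (ring_energy t).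
Proof.
move=> Jt gap_gt0; rewrite ler_pdivlMr// mulrC -ler_pdivlMr ?h_gt0//.
exact: gap_le_attraction.
Qed.

Lemma norm_ring_le t : J t -> `|x t| <= h t /\ forall j, `|y j t| <= h t.
Proof.
move=> Jt; have r_gt0 := ring_r_gt0 sol Jt.
have nm_gt0 : 0 < n%:R * m2 by exact: mulr_gt0.
have norm_le (v : 'rV[R]_3) b : (forall i, `|v 0 i| <= b) -> 0 <= b -> `|v| <= b.
  move=> vb b0; rewrite [leLHS]/Num.Def.normr/= mx_normrE (bigmax_le _ b0)//=.
  by move=> [i j] _; rewrite (ord1 i).
(* Serves both heights: $b=1$ for [x] and $b=\frac{m_1}{nm_2}=k-1$ for [y j]. *)
have f_le b : 0 <= b <= k -> `|b * f t| <= h t.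
  move=> /andP[b0 bk]; rewrite -sqrtr_sqr /h /hdist ler_wsqrtr// exprMn.
  by rewrite ler_wpDl ?sqr_ge0// ler_wpM2r ?sqr_ge0// ler_pXn2r// nnegrE ltW.
have k_ge1 : 1 <= k by rewrite ler_pdivlMr// mul1r lerDr ltW.
have r_le : r t <= h t.
  by rewrite -[leLHS]gtr0_norm// -sqrtr_sqr ler_wsqrtr// lerDl mulr_ge0 ?sqr_ge0.
have h_ge0 : 0 <= h t by rewrite ltW ?h_gt0.
split=> [|j]; apply: norm_le => //.
  rewrite (ring_xE sol Jt) => -[[|[|[|//]]] ?]; rewrite mxE/= ?normr0//.
  by rewrite -[f t]mul1r f_le// ler01.
rewrite (ring_yE sol Jt) => -[[|[|[|//]]] ?]; rewrite mxE/=.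
- rewrite normrM gtr0_norm// (le_trans _ r_le)// ger_pMr// ler_norml.
  by rewrite cos_geN1 cos_le1.
- rewrite normrM gtr0_norm// (le_trans _ r_le)// ger_pMr// ler_norml.
  by rewrite sin_geN1 sin_le1.
- rewrite mulNr normrN f_le//; apply/andP; split; first by rewrite divr_ge0 ?ltW.
  by rewrite ler_pM2r ?invr_gt0// lerDl ltW.
Qed.

End RingMotion.

Theorem theorem4p4 (R : realType) (n : nat) (m1 m2 c1 c2 : R)
    (J : set R) (t0 : R) (f r theta : R -> R)
    (x : R -> 'rV[R]_3) (y : 'I_n -> R -> 'rV[R]_3)
    (n_gt1 : (1 < n)%N) (m1_gt0 : 0 < m1) (m2_gt0 : 0 < m2)
    (J_open : open J) (J_itv : is_interval J) (J_t0 : J t0)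
    (sol : ring_solution m1 m2 c1 J f r theta x y)
    (c2E : energy m1 m2 x y t0 = c2)
    (c1_neq0 : c1 != 0) (c2_lt0 : c2 < 0)
    (c12 : 2 * c1 ^+ 2 * c2
           + n%:R * an R n * m2 ^+ 2 * (2 * m1 + (bn R n - an R n) * m2) < 0) :
  bounded_motion x y J.
Proof.
have n_gt0 := ltnW n_gt1.
pose gap := - c2 / (n%:R * m2) - an R n ^+ 2 * m2 ^+ 2 / (2 * c1 ^+ 2).
have nR_gt0 : 0 < n%:R :> R by rewrite ltr0n.
have gap_gt0 : 0 < gap.
  have c1sq_gt0 : 0 < c1 ^+ 2 by rewrite exprn_even_gt0.
  have -> : gap = - (2 * c1 ^+ 2 * c2 + n%:R * an R n ^+ 2 * m2 ^+ 3)
      / (2 * c1 ^+ 2 * (n%:R * m2)).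
    by rewrite /gap; field; rewrite c1_neq0 !gt_eqF.
  apply: divr_gt0; last by do ![apply: mulr_gt0 => //].
  (* As $b_n=2a_n$, the left side of [c12] exceeds $2c_1^2c_2+na_n^2m_2^3$ by
     $2na_nm_1m_2^2\ge0$. *)
  rewrite oppr_gt0 (le_lt_trans _ c12)// lerD2l.
  have -> : bn R n = 2 * an R n by rewrite an_bn; field.
  rewrite -subr_ge0 (_ : _ - _ = n%:R * an R n * m2 ^+ 2 * (2 * m1)); last by ring.
  by rewrite !mulr_ge0 ?an_ge0 ?sqr_ge0 ?ltW.
(* A sup-norm ball whose radius, the bound on $h$, does not depend on time. *)
exists [set v | `|v| <= m1 / gap].
  exists (m1 / gap); split; first exact: num_real.
  by move=> M /ltW leM v /= /le_trans; apply.
move=> t Jt.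
(* Conservation carries the value [c2] from [t0] to [t]. *)
have E : ring_energy R n m1 m2 c1 f r t = c2.
  rewrite -c2E (energy_ring _ _ _ _ _ _ _ _ _ _ _ n_gt0 m2_gt0 J_open sol)//.
  exact: (ring_energy_conserved _ _ _ _ _ _ _ _ _ _ _ n_gt0 m2_gt0 sol).
have h_le : hdist n m1 m2 f r t <= m1 / gap.
  have := hdist_le _ _ _ _ _ _ _ _ _ _ _ n_gt0 m1_gt0 m2_gt0 sol c1_neq0 t Jt.
  by rewrite E; apply.
have [xh yh] := norm_ring_le _ _ _ _ _ _ _ _ _ _ _ n_gt0 m1_gt0 m2_gt0 sol t Jt.
by split=> [|j] /=; apply: le_trans h_le.
Qed.
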